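(* Up to isomorphism there exist exactly $5$ nilpotent Jordan algebras of dimension $3$ over $\mathbb{R}$: every such algebra is isomorphic to one of the following pairwise non-isomorphic nilpotent Jordan algebras, each with basis $a,b,c$ (the superscript $\alpha=\pm1$ indicates two algebras, one for each sign). With central component: - $J_{3,1}$: all products are zero; - $J_{3,2}$: $a^2=b$. Without central component: - $J_{3,3}^{\alpha=\pm1}$: $a^2=c,\ b^2=\alpha c$; - $J_{3,4}$: $a^2=b,\ a\circ b=c$.
   Context: A Jordan algebra over a field $K$ is a $K$-vector space $J$ with a symmetric bilinear product $\circ:J\times J\to J$ satisfying $x^2\circ(x\circ y)=x\circ(x^2\circ y)$ for all $x,y\in J$, where $x^2=x\circ x$. Set $c^1(J)=J$ and $c^m(J)=c^{m-1}(J)\circ J$ (the span of the products) for $m\geq 2$; $J$ is nilpotent if $c^n(J)=0$ for some $n$. The centre is $Z(J)=\{x\in J: x\circ y=0\ \forall y\in J\}$. $J$ has a central component if $J=I_1\oplus I_2$ is a direct sum of two ideals with $I_2$ nonzero and contained in $Z(J)$. In the multiplication tables, products of basis vectors that are not listed (and do not follow from commutativity) are zero. *)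

(* Defs.v *)
From HB Require Import structures.
From mathcomp Require Import all_boot all_order all_algebra.
From mathcomp Require Import classical_sets reals.

Set Implicit Arguments.
Unset Strict Implicit.
Unset Printing Implicit Defensive.

Import GRing.Theory.
Local Open Scope classical_set_scope.
Local Open Scope ring_scope.

(* An algebra is given by its carrier J (a finite-dimensional vector space)
   together with its product mul : J -> J -> J. *)

Record is_jordan (K : fieldType) (J : vectType K) (mul : J -> J -> J) : Prop :=
  IsJordan {
    jordan_bilinear : bilinear_for *:%R *:%R mul;
    jordan_comm : commutative mul;
    jordan_identity : forall x y : J,
      mul (mul x x) (mul x y) = mul x (mul (mul x x) y)
  }.

Definition lin_span (K : fieldType) (J : vectType K) (S : set J) : set J :=
  [set x | exists2 X : seq J, (forall u, u \in X -> S u) & x \in <<X>>%VS].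

Definition prod_span (K : fieldType) (J : vectType K) (mul : J -> J -> J)
    (U V : set J) : set J :=
  lin_span [set z | exists u v, [/\ U u, V v & z = mul u v]].

(* c^m(J); the indexing starts at m = 1, and c^0 is c^1 by convention. *)
Definition lower_central (K : fieldType) (J : vectType K) (mul : J -> J -> J)
    (m : nat) : set J :=
  iter m.-1 (fun U => prod_span mul U setT) setT.

Definition is_nilpotent (K : fieldType) (J : vectType K)
    (mul : J -> J -> J) : Prop :=
  exists n : nat, lower_central mul n = [set 0].

Definition nilpotent_jordan (K : fieldType) (n : nat) (J : vectType K)
    (mul : J -> J -> J) : Prop :=
  [/\ is_jordan mul, is_nilpotent mul & \dim {:J} = n].

Definition centre (K : fieldType) (J : vectType K) (mul : J -> J -> J) :
    set J :=
  [set x | forall y, mul x y = 0].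

Definition is_ideal (K : fieldType) (J : vectType K) (mul : J -> J -> J)
    (I : {vspace J}) : Prop :=
  forall x y, x \in I -> mul x y \in I /\ mul y x \in I.

Definition has_central_component (K : fieldType) (J : vectType K)
    (mul : J -> J -> J) : Prop :=
  exists I1 I2 : {vspace J},
    [/\ is_ideal mul I1, is_ideal mul I2,
        (I1 + I2 = fullv)%VS /\ directv (I1 + I2),
        I2 != 0%VS & [set` I2] `<=` centre mul].

Definition alg_iso (K : fieldType) (J1 J2 : vectType K)
    (mul1 : J1 -> J1 -> J1) (mul2 : J2 -> J2 -> J2) : Prop :=
  exists f : {linear J1 -> J2},
    bijective f /\ forall x y, f (mul1 x y) = mul2 (f x) (f y).

(* The product on K^n with e_i o e_j = t i j on the canonical basis. *)
Definition table_mul (K : fieldType) (n : nat)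
    (t : 'I_n -> 'I_n -> 'rV[K]_n) (x y : 'rV[K]_n) : 'rV[K]_n :=
  \sum_(i < n) \sum_(j < n) (x 0 i * y 0 j) *: t i j.

(* The basis a, b, c of K^3; in the tables below it has indices 0, 1, 2. *)
Definition ea (K : fieldType) : 'rV[K]_3 := delta_mx 0 0.
Definition eb (K : fieldType) : 'rV[K]_3 := delta_mx 0 1.
Definition ec (K : fieldType) : 'rV[K]_3 := delta_mx 0 2.

Definition J31 (K : fieldType) : 'rV[K]_3 -> 'rV[K]_3 -> 'rV[K]_3 :=
  table_mul (fun i j : 'I_3 => 0).

Definition J32 (K : fieldType) : 'rV[K]_3 -> 'rV[K]_3 -> 'rV[K]_3 :=
  table_mul (fun i j : 'I_3 =>
    match val i, val j with
    | 0%N, 0%N => eb K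
    | _, _ => 0
    end).

Definition J33 (K : fieldType) (alpha : K) :
    'rV[K]_3 -> 'rV[K]_3 -> 'rV[K]_3 :=
  table_mul (fun i j : 'I_3 =>
    match val i, val j with
    | 0%N, 0%N => ec K
    | 1%N, 1%N => alpha *: ec K
    | _, _ => 0
    end).

Definition J34 (K : fieldType) : 'rV[K]_3 -> 'rV[K]_3 -> 'rV[K]_3 :=
  table_mul (fun i j : 'I_3 =>
    match val i, val j with
    | 0%N, 0%N => eb K
    | 0%N, 1%N | 1%N, 0%N => ec K
    | _, _ => 0
    end).

Definition J3_list (K : fieldType) :
    5.-tuple ('rV[K]_3 -> 'rV[K]_3 -> 'rV[K]_3) :=
  [tuple @J31 K; @J32 K; J33 1; J33 (-1); @J34 K].

(* Main.v *)
From HB Require Import structures.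
Require Import Defs.
From mathcomp Require Import all_boot all_order all_algebra.
From mathcomp Require Import classical_sets reals.
From mathcomp Require Import boolp ring.

Import Order.TTheory GRing.Theory Num.Theory.
Local Open Scope ring_scope.

(* If J is nilpotent and V is a proper subspace, take the last term of the lower
   central series not contained in V: it has an x outside V with x o J in V.
   Three uses of this in dimension 3 give a basis a, b, c with c central,
   b o J in <c> and a o J in <b, c>.  Only a^2 = q b + r c, ab = m c and
   b^2 = n c remain, and the Jordan identity at a forces q n = 0.  If q <> 0,
   then a, a^2, a^3 is a basis (J34) unless a^3 = 0 (J32).  If q = 0, the product
   is a symmetric bilinear form on <a, b>, which is diagonalised over R.

   In a sum I1 + I2 of ideals with I2 central, every product lies in I1, so
   there is no central component when each central element is a product. *)

(** * Bilinearity rules for the product, and symmetry of isomorphism *)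

Lemma jmulDl {K : fieldType} {J : vectType K} {mul : J -> J -> J}
  (jm : is_jordan mul) (x y z : J) : mul (x + y) z = mul x z + mul y z.
Proof.
have := (jordan_bilinear jm).1 z 1 x y.
by rewrite /= !scale1r.
Qed.

Lemma jmulDr {K : fieldType} {J : vectType K} {mul : J -> J -> J}
  (jm : is_jordan mul) (x y z : J) : mul z (x + y) = mul z x + mul z y.
Proof. by rewrite !(jordan_comm jm z) jmulDl. Qed.

Lemma jmul0l {K : fieldType} {J : vectType K} {mul : J -> J -> J}
  (jm : is_jordan mul) (z : J) : mul 0 z = 0.
Proof. by apply: (addrI (mul 0 z)); rewrite -jmulDl // !addr0. Qed.

Lemma jmulZl {K : fieldType} {J : vectType K} {mul : J -> J -> J}
  (jm : is_jordan mul) (k : K) (x z : J) : mul (k *: x) z = k *: mul x z.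
Proof.
have := (jordan_bilinear jm).1 z k x 0.
by rewrite /= jmul0l // !addr0.
Qed.

Lemma jmulZr {K : fieldType} {J : vectType K} {mul : J -> J -> J}
  (jm : is_jordan mul) (k : K) (x z : J) : mul z (k *: x) = k *: mul z x.
Proof. by rewrite !(jordan_comm jm z) jmulZl. Qed.

Lemma alg_iso_sym (K : fieldType) (J1 J2 : vectType K)
  (mul1 : J1 -> J1 -> J1) (mul2 : J2 -> J2 -> J2) :
  alg_iso mul1 mul2 -> alg_iso mul2 mul1.
Proof.
case=> f [[g fK gK] fM].
(* The inverse of a bijective linear map is linear; it is packed as such to serve as the witness. *)
pose gL := GRing.isLinear.Build K J2 J1 *:%R g (can2_linear fK gK).
pose h : {linear J2 -> J1} := HB.pack g gL.
exists h; split; first by exists f.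
by move=> x y /=; apply: (can_inj fK); rewrite fM !gK.
Qed.

(** * Coordinates with respect to a basis of three vectors *)

Definition lincomb3 {K : fieldType} {J : vectType K} (a b c : J)
  (u : 'rV[K]_3) : J := u 0 0 *: a + u 0 1 *: b + u 0 2 *: c.

Lemma lincomb3_linear (K : fieldType) (J : vectType K) (a b c : J) :
  linear (lincomb3 a b c).
Proof.
move=> k u v; rewrite /lincomb3 !mxE !scalerDl !scalerDr !scalerA.
by rewrite [RHS]addrACA; congr (_ + _); rewrite [RHS]addrACA.
Qed.

HB.instance Definition _ (K : fieldType) (J : vectType K) (a b c : J) :=
  GRing.isLinear.Build K 'rV[K]_3 J *:%R (lincomb3 a b c)
    (@lincomb3_linear K J a b c).

Lemma rowP3 (K : fieldType) (u v : 'rV[K]_3) :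
  u 0 0 = v 0 0 -> u 0 1 = v 0 1 -> u 0 2 = v 0 2 -> u = v.
Proof.
move=> e0 e1 e2; apply/rowP => -[[|[|[|//]]] i_lt].
- by rewrite (_ : Ordinal i_lt = 0) //; apply: val_inj.
- by rewrite (_ : Ordinal i_lt = 1) //; apply: val_inj.
- by rewrite (_ : Ordinal i_lt = 2) //; apply: val_inj.
Qed.

Lemma lincomb3_bij (K : fieldType) (J : vectType K) (a b c : J) :
  basis_of fullv [:: a; b; c] -> bijective (lincomb3 a b c).
Proof.
move=> Xb; pose X : 3.-tuple J := [tuple a; b; c].
have lX u : lincomb3 a b c u = \sum_i u 0 i *: X`_i.
  by rewrite 3!big_ord_recl big_ord0 /lincomb3 addr0 /= !addrA;
     congr (_ + _ *: _ + _ *: _); congr (u 0 _); apply: val_inj.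
exists (fun v => \row_i coord X i v) => [u|v].
  by apply/rowP => i; rewrite mxE lX coord_sum_free // (basis_free Xb).
rewrite lX [RHS](coord_basis (X := X) Xb (memvf v)).
by apply: eq_bigr => i _; rewrite mxE.
Qed.

(** Three vectors whose span contains a basis span the whole space, and three spanning vectors in
    dimension 3 are free. *)
Lemma basis3_change {K : fieldType} {J : vectType K} {a b c} (a' b' c' : J) :
  basis_of fullv [:: a; b; c] ->
  {subset [:: a; b; c] <= <<[:: a'; b'; c']>>%VS} ->
  basis_of fullv [:: a'; b'; c'].
Proof.
move=> Xb sub; rewrite basisEdim -(span_basis Xb); apply/andP; split.
  exact/span_subvP.
by rewrite (eqP (basis_free Xb)).
Qed.

Lemma span3P {K : fieldType} {J : vectType K} {a b c : J} (p q r : K) v :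
  v = p *: a + q *: b + r *: c -> v \in <<[:: a; b; c]>>%VS.
Proof.
by move->; rewrite !rpredD ?rpredZ ?memv_span ?inE ?eqxx ?orbT.
Qed.

(** The isomorphism is the inverse of [lincomb3 a b c]. Since [c] is central, the products of [a]
    and [b] determine [mul], so multiplicativity comes down to one identity in coordinates. *)
Lemma alg_iso_basis {K : fieldType} {J : vectType K} {mul : J -> J -> J}
  {a b c : J} (mul' : 'rV[K]_3 -> 'rV[K]_3 -> 'rV[K]_3) :
  is_jordan mul -> basis_of fullv [:: a; b; c] -> (forall y, mul c y = 0) ->
  (forall u v, lincomb3 a b c (mul' u v) =
     (u 0 0 * v 0 0) *: mul a a + (u 0 0 * v 0 1 + u 0 1 * v 0 0) *: mul a b +
     (u 0 1 * v 0 1) *: mul b b) ->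
  alg_iso mul mul'.
Proof.
move=> jm Xb cZ tab; apply: alg_iso_sym.
exists (lincomb3 a b c); split; first exact: lincomb3_bij.
move=> u v; rewrite /= tab /lincomb3 !(jmulDl jm, jmulDr jm).
rewrite !(jmulZl jm, jmulZr jm) !(jordan_comm jm _ c) !cZ.
rewrite (jordan_comm jm b a) !scaler0 !addr0 !scalerA scalerDl.
by rewrite !addrA.
Qed.

(** * From nilpotency to a basis adapted to a flag *)

Lemma not_sub_flag {K : fieldType} {J : vectType K} {mul : J -> J -> J}
  (V : {vspace J}) : is_nilpotent mul -> V != fullv ->
  exists2 x, x \notin V & forall y, mul x y \in V.
Proof.
case=> n nilp VnF.
have: (lower_central mul n `<=` [set` V])%classic.
  by rewrite nilp => x ->; apply: mem0v.
rewrite /lower_central; elim: n.-1 => [|m IHm] sub.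
  by case/negP: VnF; rewrite eqEsubv subvf; apply/subvP => x _; apply: sub.
(* Either the previous term already lies in [V], and the induction goes on, or it has an element
   outside [V], whose products lie in the next term and hence in [V]. *)
have [/IHm//|/nonsubset [x [Ux /negP Vx]]] :=
  EM (iter m (fun U => prod_span mul U setT) setT `<=` [set` V])%classic.
exists x => // y; apply: sub; exists [:: mul x y]; last first.
  by rewrite memv_span ?inE.
by move=> u; rewrite inE => /eqP ->; exists x, y.
Qed.

Lemma nilpotent_basis {K : fieldType} {J : vectType K} {mul : J -> J -> J} :
  nilpotent_jordan 3 mul -> exists a b c : J,
  [/\ basis_of fullv [:: a; b; c], forall y, mul c y = 0,
      forall y, mul b y \in <<[:: c]>>%VS
    & forall y, mul a y \in <<[:: b; c]>>%VS].
Proof.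
case=> jm nilp dimJ.
have small (X : seq J) : (size X < 3)%N -> <<X>>%VS != fullv.
  apply: contraTneq => XF; rewrite -leqNgt -dimJ -XF; exact: dim_span.
have [c cN cZ] := not_sub_flag _ nilp (small [::] isT).
have [b bN bZ] := not_sub_flag _ nilp (small [:: c] isT).
have [a aN aZ] := not_sub_flag _ nilp (small [:: b; c] isT).
exists a, b, c; split => //.
  (* Each vector was chosen outside the span of those before it, so the three are free. *)
  rewrite basisEfree subvf dimJ andbT /= 3!free_cons aN bN cN.
  by rewrite nil_free.
by move=> y; have := cZ y; rewrite span_nil memv0 => /eqP.
Qed.

(** * The multiplication tables in coordinates, and recognition of each algebra from a basis *)

Lemma J31E (K : fieldType) (x y : 'rV[K]_3) : J31 x y = 0.
Proof.
rewrite /J31 /table_mul big1 // => i _.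
by rewrite big1 // => j _; rewrite scaler0.
Qed.

Lemma table_mul3 (K : fieldType) (t : 'I_3 -> 'I_3 -> 'rV[K]_3) x y :
  table_mul t x y =
    (x 0 0 * y 0 0) *: t 0 0 + (x 0 0 * y 0 1) *: t 0 1 +
      (x 0 0 * y 0 2) *: t 0 2 +
    ((x 0 1 * y 0 0) *: t 1 0 + (x 0 1 * y 0 1) *: t 1 1 +
      (x 0 1 * y 0 2) *: t 1 2) +
    ((x 0 2 * y 0 0) *: t 2 0 + (x 0 2 * y 0 1) *: t 2 1 +
      (x 0 2 * y 0 2) *: t 2 2).
Proof.
have e1 : lift ord0 ord0 = 1 :> 'I_3 by apply: val_inj.
have e2 : lift ord0 (lift ord0 ord0) = 2 :> 'I_3 by apply: val_inj.
by rewrite /table_mul !big_ord_recl !big_ord0 !addr0 e2 e1 !addrA.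
Qed.

Lemma J32E (K : fieldType) (x y : 'rV[K]_3) :
  J32 x y = (x 0 0 * y 0 0) *: eb K.
Proof. by rewrite /J32 table_mul3 /= !scaler0 !addr0. Qed.

Lemma J33E (K : fieldType) (alpha : K) (x y : 'rV[K]_3) :
  J33 alpha x y = (x 0 0 * y 0 0 + alpha * (x 0 1 * y 0 1)) *: ec K.
Proof.
rewrite /J33 table_mul3 /= !scaler0 !addr0 add0r scalerA -scalerDl.
by rewrite [alpha * _]mulrC.
Qed.

Lemma J34E (K : fieldType) (x y : 'rV[K]_3) :
  J34 x y = (x 0 0 * y 0 0) *: eb K + (x 0 0 * y 0 1 + x 0 1 * y 0 0) *: ec K.
Proof.
by rewrite /J34 table_mul3 /= !scaler0 !addr0 -addrA -scalerDl.
Qed.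

Lemma central_of_basis {K : fieldType} {J : vectType K} {mul : J -> J -> J}
  {a b c : J} (z : J) :
  is_jordan mul -> basis_of fullv [:: a; b; c] ->
  mul a z = 0 -> mul b z = 0 -> mul c z = 0 -> forall y, mul z y = 0.
Proof.
move=> jm /lincomb3_bij[g _ gK] az bz cz y; rewrite (jordan_comm jm) -(gK y).
by rewrite /lincomb3 !(jmulDl jm) !(jmulZl jm) az bz cz !scaler0 !addr0.
Qed.

Lemma alg_iso_J31 {K : fieldType} {J : vectType K} {mul : J -> J -> J}
  {a b c : J} :
  is_jordan mul -> basis_of fullv [:: a; b; c] -> (forall y, mul c y = 0) ->
  mul a a = 0 -> mul a b = 0 -> mul b b = 0 -> alg_iso mul (@J31 K).
Proof.
move=> jm Xb cZ aa ab bb; apply: (alg_iso_basis _ jm Xb cZ) => u v.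
by rewrite J31E aa ab bb !scaler0 linear0 !addr0.
Qed.

Lemma alg_iso_J32 {K : fieldType} {J : vectType K} {mul : J -> J -> J}
  {a b c : J} :
  is_jordan mul -> basis_of fullv [:: a; b; c] -> (forall y, mul c y = 0) ->
  mul a a = b -> mul a b = 0 -> mul b b = 0 -> alg_iso mul (@J32 K).
Proof.
move=> jm Xb cZ aa ab bb; apply: (alg_iso_basis _ jm Xb cZ) => u v.
rewrite J32E aa ab bb linearZ /= /lincomb3 !mxE /= !scaler0 !scale0r.
by rewrite scale1r add0r !addr0.
Qed.

Lemma alg_iso_J33 {K : fieldType} {J : vectType K} {mul : J -> J -> J}
  {a b c : J} (alpha : K) :
  is_jordan mul -> basis_of fullv [:: a; b; c] -> (forall y, mul c y = 0) ->
  mul a a = c -> mul a b = 0 -> mul b b = alpha *: c ->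
  alg_iso mul (J33 alpha).
Proof.
move=> jm Xb cZ aa ab bb; apply: (alg_iso_basis _ jm Xb cZ) => u v.
rewrite J33E aa ab bb linearZ /= /lincomb3 !mxE /= !scaler0 !scale0r.
by rewrite scale1r !add0r addr0 scalerA -scalerDl [alpha * _]mulrC.
Qed.

Lemma alg_iso_J34 {K : fieldType} {J : vectType K} {mul : J -> J -> J}
  {a b c : J} :
  is_jordan mul -> basis_of fullv [:: a; b; c] -> (forall y, mul c y = 0) ->
  mul a a = b -> mul a b = c -> mul b b = 0 -> alg_iso mul (@J34 K).
Proof.
move=> jm Xb cZ aa ab bb; apply: (alg_iso_basis _ jm Xb cZ) => u v.
rewrite J34E aa ab bb linearD !linearZ /= /lincomb3 !mxE /=.
by rewrite !scaler0 !scale0r !scale1r !add0r !addr0.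
Qed.

(** * Classification over a real closed field *)

Lemma iso_in_list {K : fieldType} {J : vectType K} {mul : J -> J -> J} k :
  (k < 5)%N -> alg_iso mul (nth (@J31 K) (J3_list K) k) ->
  exists i : 'I_5, alg_iso mul (tnth (J3_list K) i).
Proof. by move=> k5 iso; exists (Ordinal k5); rewrite (tnth_nth (@J31 K)). Qed.

(* Gram-Schmidt on the symmetric form on <a, b> with values in <c>. *)
Lemma classify_anisotropic {R : rcfType} {J : vectType R} {mul : J -> J -> J}
  {a b c : J} {r m n : R} :
  is_jordan mul -> basis_of fullv [:: a; b; c] -> (forall y, mul c y = 0) ->
  mul a a = r *: c -> mul a b = m *: c -> mul b b = n *: c -> r != 0 ->
  exists i : 'I_5, alg_iso mul (tnth (J3_list R) i).
Proof.
move=> jm Xb cZ aa ab bb r0.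
(* [b'] is [b] made orthogonal to [a], and [d] is the value of the form at [b'] when the new third
   vector [r *: c] is the unit. *)
pose d := (n - m ^+ 2 / r) / r; pose b' := b - (m / r) *: a.
have ab' : mul a b' = 0.
  rewrite /b' (jmulDr jm) -scaleNr (jmulZr jm) aa ab scalerA -scalerDl.
  by rewrite mulNr divfK // subrr scale0r.
have bb' : mul b' b' = d *: (r *: c).
  rewrite {2}/b' (jmulDr jm) -scaleNr (jmulZr jm) (jordan_comm jm b' a) ab'.
  rewrite scaler0 addr0 /b' (jmulDl jm) -scaleNr (jmulZl jm) ab bb.
  by rewrite !scalerA -scalerDl; congr (_ *: _); rewrite /d; field.
have rcZ y : mul (r *: c) y = 0 by rewrite (jmulZl jm) cZ scaler0.
(* For a degenerate form [b'] is central, and [a], [a^2 = r *: c], [b'] is a basis of type [J32]. *)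
have [d0|d0] := eqVneq d 0.
  apply: (iso_in_list 1) => //=.
  have Xb2 : basis_of fullv [:: a; r *: c; b'].
    apply: (basis3_change _ _ _ Xb) => v; rewrite !inE => /or3P[] /eqP ->.
    + by apply: (span3P 1 0 0); rewrite scale1r !scale0r !addr0.
    + apply: (span3P (m / r) 0 1).
      by rewrite scale0r addr0 scale1r addrC subrK.
    + by apply: (span3P 0 r^-1 0); rewrite !scale0r scalerA mulVf // scale1r
        addr0 add0r.
  apply: (alg_iso_J32 jm Xb2) => //.
  - apply: (central_of_basis _ jm Xb2) => //.
    by rewrite bb' d0 scale0r.
  - by rewrite (jordan_comm jm).
(* Dividing [b'] by the square root of the absolute value of [d] replaces [d] by its sign, which
   selects the algebra [J33]. *)
pose e := Num.sqrt `|d|; have e0 : e != 0.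
  by rewrite sqrtr_eq0 -ltNge normr_gt0.
have Xb2 : basis_of fullv [:: a; e^-1 *: b'; r *: c].
  apply: (basis3_change _ _ _ Xb) => v; rewrite !inE => /or3P[] /eqP ->.
  + by apply: (span3P 1 0 0); rewrite scale1r !scale0r !addr0.
  + apply: (span3P (m / r) e 0).
    by rewrite scale0r addr0 scalerA divff // scale1r addrC subrK.
  + by apply: (span3P 0 0 r^-1); rewrite !scale0r scalerA mulVf // scale1r
      !add0r.
have ab2 : mul a (e^-1 *: b') = 0 by rewrite (jmulZr jm) ab' scaler0.
have bb2 : mul (e^-1 *: b') (e^-1 *: b') = Num.sg d *: (r *: c).
  rewrite (jmulZr jm) (jmulZl jm) bb' !scalerA; congr (_ *: _).
  rewrite [in LHS](numEsg d) -(sqr_sqrtr (normr_ge0 d)) -/e; field.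
  exact: e0.
have [d_gt0|d_le0] := ltrP 0 d.
  apply: (iso_in_list 2) => //=.
  by apply: (alg_iso_J33 _ jm Xb2); rewrite // bb2 gtr0_sg.
apply: (iso_in_list 3) => //=.
by apply: (alg_iso_J33 _ jm Xb2); rewrite // bb2 ltr0_sg // lt_neqAle d0.
Qed.

Lemma classify_nilpotent (R : rcfType) (J : vectType R) (mul : J -> J -> J) :
  nilpotent_jordan 3 mul ->
  exists i : 'I_5, alg_iso mul (tnth (J3_list R) i).
Proof.
move=> nj; have [jm _ _] := nj.
have [a [b [c [Xb cZ bZ aZ]]]] := nilpotent_basis nj.
have c0 : c != 0.
  by have := basis_free Xb; rewrite 2!free_cons seq1_free => /and3P[].
have [n bb] : exists n, mul b b = n *: c.
  by apply/vlineP; rewrite -span_seq1.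
have [m ab] : exists m, mul a b = m *: c.
  by apply/vlineP; rewrite -span_seq1 (jordan_comm jm).
have [q [r aa]] : exists q r, mul a a = q *: b + r *: c.
  have := aZ a; rewrite span_cons span_seq1.
  by case/memv_addP=> _ /vlineP[q ->] [_ /vlineP[r ->] ->]; exists q, r.
have [q0|q0] := eqVneq q 0.
  rewrite q0 scale0r add0r in aa.
  have [r0|r0] := eqVneq r 0; last first.
    exact: (classify_anisotropic jm Xb cZ aa ab bb).
  (* If [a] is isotropic and [b] is not, the two exchange roles. *)
  have [n0|n0] := eqVneq n 0; last first.
    rewrite (jordan_comm jm) in ab.
    apply: (classify_anisotropic jm _ cZ bb ab aa) => //.
    apply: (basis3_change _ _ _ Xb) => v Xv; apply: memv_span.
    by move: Xv; rewrite !inE => /or3P[] ->; rewrite ?orbT.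
  rewrite r0 n0 scale0r in aa bb.
  have [m0|m0] := eqVneq m 0.
    rewrite m0 scale0r in ab; apply: (iso_in_list 0) => //=.
    exact: (alg_iso_J31 jm Xb).
  (* Both [a] and [b] are isotropic but [a o b] is not zero: then [(a + b)^2 = 2 m c] is nonzero in
     characteristic 0, and [a + b] replaces [a]. *)
  apply: (@classify_anisotropic _ _ _ (a + b) b c (2 * m) m 0 jm) => //.
  - apply: (basis3_change _ _ _ Xb) => v; rewrite !inE => /or3P[] /eqP ->.
    + apply: (span3P 1 (-1) 0).
      by rewrite !scale1r scaleN1r scale0r addr0 addrK.
    + by apply: (span3P 0 1 0); rewrite !scale0r scale1r addr0 add0r.
    + by apply: (span3P 0 0 1); rewrite !scale0r scale1r !add0r.
  - rewrite (jmulDr jm) !(jmulDl jm) (jordan_comm jm b a) aa ab bb.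
    by rewrite add0r addr0 -scalerDl; congr (_ *: _); ring.
  - by rewrite (jmulDl jm) ab bb addr0.
  - by rewrite bb scale0r.
  - by rewrite mulf_neq0 // pnatr_eq0.
have aab : mul (mul a a) b = (q * n) *: c.
  by rewrite aa (jmulDl jm) !(jmulZl jm) bb cZ scaler0 addr0 scalerA.
have aaa : mul a (mul a a) = (q * m) *: c.
  rewrite aa (jmulDr jm) !(jmulZr jm) ab (jordan_comm jm a c) cZ.
  by rewrite scaler0 addr0 scalerA.
(* The Jordan identity at [x = y = a] gives [a^2 o a^2 = a o (a^2 o a)], and [a^2 o a] is a multiple
   of the central [c]. *)
have aaaa : mul (mul a a) (mul a a) = 0.
  rewrite (jordan_identity jm) (jordan_comm jm _ a) aaa (jmulZr jm).
  by rewrite (jordan_comm jm) cZ scaler0.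
have n0 : n = 0.
  (* Expanding one factor [a^2] as [q b + r c] turns the vanishing product into [q^2 n c = 0]. *)
  move/eqP: aaaa; rewrite {2}aa (jmulDr jm) !(jmulZr jm) aab.
  rewrite (jordan_comm jm _ c) cZ scaler0 addr0 scalerA scaler_eq0.
  by rewrite (negPf c0) orbF !mulf_eq0 (negPf q0) /= => /eqP.
rewrite n0 mulr0 scale0r in aab bb.
(* As [q] is invertible, [b] can be traded for [a^2] in the basis. *)
have bE : b = q^-1 *: mul a a + (- (q^-1 * r)) *: c.
  rewrite aa scalerDr !scalerA mulVf // scale1r -addrA -scalerDl subrr.
  by rewrite scale0r addr0.
have [m0|m0] := eqVneq m 0.
  apply: (iso_in_list 1) => //=.
  apply: (@alg_iso_J32 _ _ _ a (mul a a) c jm) => //; last first.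
    by rewrite aaa m0 mulr0 scale0r.
  apply: (basis3_change _ _ _ Xb) => v; rewrite !inE => /or3P[] /eqP ->.
  + by apply: (span3P 1 0 0); rewrite !scale0r scale1r !addr0.
  + by rewrite bE; apply: (span3P 0 _ _); rewrite scale0r add0r.
  + by apply: (span3P 0 0 1); rewrite !scale0r scale1r !add0r.
apply: (iso_in_list 4) => //=.
(* The third vector is [a^3], by [aaa]. *)
apply: (@alg_iso_J34 _ _ _ a (mul a a) ((q * m) *: c) jm) => //; last first.
  by move=> y; rewrite (jmulZl jm) cZ scaler0.
have qm0 : q * m != 0 by rewrite mulf_neq0.
have cE : c = (q * m)^-1 *: ((q * m) *: c) by rewrite scalerA mulVf // scale1r.
apply: (basis3_change _ _ _ Xb) => v; rewrite !inE => /or3P[] /eqP ->.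
+ by apply: (span3P 1 0 0); rewrite !scale0r scale1r !addr0.
+ rewrite bE; apply: (span3P 0 q^-1 (- (q^-1 * r) * (q * m)^-1)).
  by rewrite scale0r add0r {1}cE scalerA.
+ by rewrite {1}cE; apply: (span3P 0 0 _); rewrite !scale0r !add0r.
Qed.

(** * The listed algebras are nilpotent Jordan algebras *)

Lemma prod_span_sub (K : fieldType) (J : vectType K) (mul : J -> J -> J)
  (U : set J) (V : {vspace J}) :
  (forall x y, U x -> mul x y \in V) ->
  (prod_span mul U setT `<=` [set` V])%classic.
Proof.
move=> UV x [X XS]; apply/subvP/span_subvP => v /XS[u [w [Uu _ ->]]].
exact: UV.
Qed.

(** Multiplication by J moves each term of the flag J, [<b, c>], [<c>], 0 into the next one. Since
    [c^1] is J itself, three multiplications reach [c^4 = 0]. *)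
Lemma nilpotent_of_flag {K : fieldType} {J : vectType K} {mul : J -> J -> J}
  {b c : J} : is_jordan mul -> (forall y, mul c y = 0) ->
  (forall y, mul b y \in <<[:: c]>>%VS) ->
  (forall x y, mul x y \in <<[:: b; c]>>%VS) -> is_nilpotent mul.
Proof.
move=> jm cZ bZ aZ; exists 4; rewrite /lower_central /=.
apply/seteqP; split=> [|_ ->]; last by exists [::] => //; apply: mem0v.
move=> x Ux; apply/eqP; rewrite -memv0; move: x Ux.
apply: prod_span_sub => x y Ux.
have /vlineP[k ->] : x \in <[c]>%VS; last first.
  by rewrite (jmulZl jm) cZ scaler0 mem0v.
move: x Ux; apply: prod_span_sub => x z Ux; rewrite -span_seq1.
have : x \in <<[:: b; c]>>%VS by apply: prod_span_sub Ux => u v _; apply: aZ.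
rewrite span_cons span_seq1.
case/memv_addP=> _ /vlineP[q ->] [_ /vlineP[r ->] ->].
by rewrite (jmulDl jm) !(jmulZl jm) cZ scaler0 addr0 rpredZ // -span_seq1.
Qed.

Lemma table_mul_bilinear (K : fieldType) n (t : 'I_n -> 'I_n -> 'rV[K]_n) :
  bilinear_for *:%R *:%R (table_mul t).
Proof.
split=> z k x y; rewrite /= /table_mul scaler_sumr -big_split;
  apply: eq_bigr => i _ /=; rewrite scaler_sumr -big_split; apply: eq_bigr => j _ /=;
  rewrite !mxE scalerA -scalerDl; congr (_ *: _); ring.
Qed.

(** The two signs are merged into one case because the verifications that use this split hold for
    every [alpha]. *)
Lemma J3_list_cases (K : fieldType) (i : 'I_5) :
  let mul := tnth (J3_list K) i in
  [\/ mul = @J31 K, mul = @J32 K, exists alpha, mul = J33 alpha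
     | mul = @J34 K].
Proof.
rewrite (tnth_nth (@J31 K)).
case: i => -[|[|[|[|[|//]]]]] _ /=; [exact: Or41|exact: Or42| | |exact: Or44].
- by apply: Or43; exists 1.
- by apply: Or43; exists (-1).
Qed.

Lemma J3_list_nilpotent (K : fieldType) (i : 'I_5) :
  nilpotent_jordan 3 (tnth (J3_list K) i).
Proof.
have mulE := (@J31E K, @J32E K, @J33E K, @J34E K).
have jor : is_jordan (tnth (J3_list K) i).
  case: (J3_list_cases K i) => [->|->|[alpha ->]|->];
    (split; [exact: (@table_mul_bilinear K 3 _) | |]) => x y; rewrite !mulE //;
    by apply: rowP3; rewrite !mxE /=; ring.
split => //; last by rewrite dimvf dim_matrix.
(* The same flag serves all the tables: products never involve [a], and products with [b] lie in
   [<c>]. *)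
apply: (@nilpotent_of_flag _ _ _ (eb K) (ec K) jor).
- case: (J3_list_cases K i) => [->|->|[alpha ->]|->] y; rewrite !mulE //;
    by apply: rowP3; rewrite !mxE /=; ring.
- move=> y; rewrite span_seq1; apply/vlineP.
  case: (J3_list_cases K i) => [->|->|[alpha ->]|->]; rewrite !mulE.
  + by exists 0; rewrite scale0r.
  + by exists 0; rewrite !mxE /= mul0r !scale0r.
  + by eexists.
  + by eexists; rewrite !mxE /= mul0r scale0r add0r.
- move=> x y; case: (J3_list_cases K i) => [->|->|[alpha ->]|->]; rewrite !mulE;
    by rewrite ?mem0v ?rpredD ?rpredZ ?memv_span ?inE ?eqxx ?orbT.
Qed.

(** * Invariants separating the listed algebras *)

(* Property k holds for algebra k of the list and fails for all later ones. *)
Definition invariant {K : fieldType} {J : vectType K} (mul : J -> J -> J)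
  (k : nat) : Prop :=
  match k with
  | 0 => forall x y, mul x y = 0
  | 1 => forall x y, mul x y = 0 -> centre mul x \/ centre mul y
  | 2 => forall x, mul x x = 0 -> centre mul x
  | _ => forall x y z, mul (mul x y) z = 0
  end.

(** Each property concludes that certain products vanish for all arguments, so it can be pulled back
    along an injective homomorphism. *)
Lemma invariant_iso (K : fieldType) (J1 J2 : vectType K)
  (mul1 : J1 -> J1 -> J1) (mul2 : J2 -> J2 -> J2) k :
  alg_iso mul1 mul2 -> invariant mul2 k -> invariant mul1 k.
Proof.
case=> f [/bij_inj f_inj fM].
have f0 x : f x = 0 -> x = 0 by move=> fx0; apply: f_inj; rewrite fx0 linear0.
have centre_f x : centre mul2 (f x) -> centre mul1 x.
  by move=> fxZ y; apply: f0; rewrite fM fxZ.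
case: k => [|[|[|k]]] /= inv2.
- by move=> x y; apply: f0; rewrite fM.
- move=> x y /(congr1 f); rewrite fM linear0 => /inv2.
  by case=> /centre_f; [left | right].
- by move=> x /(congr1 f); rewrite fM linear0 => /inv2 /centre_f.
- by move=> x y z; apply: f0; rewrite !fM.
Qed.

Lemma scale_delta3 {K : fieldType} {k : K} {i : 'I_3} :
  k *: (delta_mx 0 i : 'rV[K]_3) = 0 -> k = 0.
Proof. by move/rowP/(_ i); rewrite !mxE !eqxx mulr1. Qed.

Lemma delta3_neq0 (K : fieldType) (i : 'I_3) : (delta_mx 0 i : 'rV[K]_3) <> 0.
Proof.
by rewrite -[delta_mx _ _]scale1r => /scale_delta3/eqP; rewrite oner_eq0.
Qed.

Lemma J3_list_invariant (K : realFieldType) (i j : 'I_5) :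
  (i < j)%N ->
  invariant (tnth (J3_list K) i) i /\ ~ invariant (tnth (J3_list K) j) i.
Proof.
have simp := (mulr0, mul0r, mulr1, addr0, add0r, scale0r, scale1r).
have aa32 : J32 (ea K) (ea K) = eb K by rewrite J32E !mxE /= !simp.
have aa33 alpha : J33 alpha (ea K) (ea K) = ec K.
  by rewrite J33E !mxE /= !simp.
have ab33 alpha : J33 alpha (ea K) (eb K) = 0 by rewrite J33E !mxE /= !simp.
have bb33 alpha : J33 alpha (eb K) (eb K) = alpha *: ec K.
  by rewrite J33E !mxE /= !simp.
have aa34 : J34 (ea K) (ea K) = eb K by rewrite J34E !mxE /= !simp.
have ba34 : J34 (eb K) (ea K) = ec K by rewrite J34E !mxE /= !simp.
have bb34 : J34 (eb K) (eb K) = 0 by rewrite J34E !mxE /= !simp.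
have holds0 : invariant (@J31 K) 0 by move=> x y; rewrite J31E.
have holds1 : invariant (@J32 K) 1.
  move=> x y; rewrite J32E => /scale_delta3/eqP; rewrite mulf_eq0.
  by case/orP=> /eqP x0; [left|right] => z; rewrite J32E x0 !simp.
have holds2 : invariant (J33 (1 : K)) 2.
  move=> x; rewrite J33E mul1r => /scale_delta3/eqP.
  (* The order of the field enters here: a sum of two squares vanishes only if both terms do. This
     is what tells [alpha = 1] from [alpha = -1]. *)
  rewrite paddr_eq0 ?sqr_ge0 // !mulf_eq0 !orbb => /andP[/eqP x0 /eqP x1] y.
  by rewrite J33E x0 x1 !simp.
have holds3 alpha : invariant (J33 (alpha : K)) 3.
  by move=> x y z; rewrite !J33E !mxE /= !simp.
have fails0_32 : ~ invariant (@J32 K) 0.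
  by move/(_ (ea K) (ea K)); rewrite aa32; apply: delta3_neq0.
have fails0_33 alpha : ~ invariant (J33 (alpha : K)) 0.
  by move/(_ (ea K) (ea K)); rewrite aa33; apply: delta3_neq0.
have fails0_34 : ~ invariant (@J34 K) 0.
  by move/(_ (ea K) (ea K)); rewrite aa34; apply: delta3_neq0.
(* The witnesses are [a] and [b]: their product is zero, but [a^2 = c] and [b^2 = alpha c] show that
   neither is central. *)
have fails1_33 alpha : alpha != 0 -> ~ invariant (J33 (alpha : K)) 1.
  move=> /eqP alpha0 /(_ _ _ (ab33 alpha))[/(_ (ea K))|/(_ (eb K))].
    by rewrite aa33; apply: delta3_neq0.
  by rewrite bb33 => /scale_delta3.
(* In [J34] the vector [b] has square zero without being central, which refutes both property 1 and
   property 2. *)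
have b34 : ~ centre (@J34 K) (eb K).
  by move/(_ (ea K)); rewrite ba34; apply: delta3_neq0.
have fails1_34 : ~ invariant (@J34 K) 1 by move/(_ _ _ bb34) => [].
have fails2_33 : ~ invariant (J33 (-1 : K)) 2.
  (* For [alpha = -1] the vector [a + b] is isotropic, as [c - c = 0], yet its product with [a] is
     [c]. *)
  move/(_ (ea K + eb K)); rewrite J33E !mxE /= !simp subrr scale0r.
  move=> /(_ erefl) /(_ (ea K)); rewrite J33E !mxE /= !simp.
  exact: delta3_neq0.
have fails2_34 : ~ invariant (@J34 K) 2 by move/(_ _ bb34).
have fails3_34 : ~ invariant (@J34 K) 3.
  move/(_ (ea K) (ea K) (ea K)); rewrite aa34 ba34; exact: delta3_neq0.
rewrite !(tnth_nth (@J31 K)).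
case: i j => -[|[|[|[|[|//]]]]] _ [[|[|[|[|[|//]]]]] _] //= _; split=> //.
- exact: (fails0_33 1).
- exact: (fails0_33 (-1)).
- exact: (fails1_33 1 (oner_neq0 K)).
- by apply: (fails1_33 (-1)); rewrite oppr_eq0 oner_eq0.
- exact: (holds3 (-1)).
Qed.

(** The property numbered by the smaller of the two indices would pass along an isomorphism to the
    algebra with the larger index, where it fails. *)
Lemma J3_list_pairwise (K : realFieldType) (i j : 'I_5) :
  i <> j -> ~ alg_iso (tnth (J3_list K) i) (tnth (J3_list K) j).
Proof.
move=> /eqP neq_ij iso; have [lt_ij|lt_ji|eq_ij] := ltngtP i j.
- have [inv_i ninv_j] := J3_list_invariant K _ _ lt_ij.
  by apply: ninv_j; apply: invariant_iso inv_i; apply: alg_iso_sym.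
- have [inv_j ninv_i] := J3_list_invariant K _ _ lt_ji.
  by apply: ninv_i; apply: invariant_iso inv_j.
- by case/eqP: neq_ij; apply: val_inj.
Qed.

(** * Central components *)

Lemma no_central_component {K : fieldType} {J : vectType K}
  {mul : J -> J -> J} : is_jordan mul ->
  (forall z, centre mul z -> exists x y, z = mul x y) ->
  ~ has_central_component mul.
Proof.
move=> jm Zprod [I1 [I2 [id1 _ [I12 dir] I2N I2Z]]].
case/negP: I2N; rewrite -subv0; apply/subvP => z z2.
move/directv_addP: dir => <-; rewrite memv_cap z2 andbT.
have [x [y ->]] := Zprod z (I2Z z z2).
(* Only the left factor of [z = x o y] is split: its part in [I2] is central, so [z = x1 o y] lies
   in the ideal [I1]. *)
have /memv_addP[x1 x1I [x2 x2I ->]] : x \in (I1 + I2)%VS by rewrite I12 memvf.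
by rewrite (jmulDl jm) (I2Z x2) // addr0; case: (id1 x1 y x1I).
Qed.

Lemma J33_no_central_component (K : fieldType) (alpha : K) :
  alpha != 0 -> is_jordan (J33 alpha) -> ~ has_central_component (J33 alpha).
Proof.
move=> alpha0 jm; apply: (no_central_component jm) => z zZ.
(* Multiplying a central [z] by [a] and by [b] kills its first two coordinates, so [z] is a multiple
   of [c = a^2]. *)
have z0 : z 0 0 = 0.
  have := zZ (ea K); rewrite J33E !mxE /= => /scale_delta3.
  by rewrite mulr1 !mulr0 addr0.
have z1 : z 0 1 = 0.
  have := zZ (eb K); rewrite J33E !mxE /= => /scale_delta3/eqP.
  by rewrite mulr1 mulr0 add0r mulf_eq0 (negPf alpha0) => /eqP.
exists (z 0 2 *: ea K), (ea K); rewrite J33E !mxE /=.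
by apply: rowP3; rewrite !mxE /= ?z0 ?z1; ring.
Qed.

Lemma J34_no_central_component (K : fieldType) :
  is_jordan (@J34 K) -> ~ has_central_component (@J34 K).
Proof.
move=> jm; apply: (no_central_component jm) => z zZ.
(* The product with [b] isolates the first coordinate; once that is zero, the product with [a]
   isolates the second. What remains is a multiple of [c = a o b]. *)
have z0 : z 0 0 = 0.
  have := zZ (eb K); rewrite J34E !mxE /= mulr0 scale0r add0r.
  by move/scale_delta3; rewrite mulr1 mulr0 addr0.
have z1 : z 0 1 = 0.
  have := zZ (ea K); rewrite J34E !mxE /= z0 !mul0r scale0r !add0r.
  by move/scale_delta3; rewrite mulr1.
exists (z 0 2 *: ea K), (eb K); rewrite J34E !mxE /=.
by apply: rowP3; rewrite !mxE /= ?z0 ?z1; ring.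
Qed.

Lemma J31_central_component (K : fieldType) : has_central_component (@J31 K).
Proof.
exists 0%VS, fullv; split.
- by move=> x y _; rewrite !J31E mem0v.
- by move=> x y _; rewrite !memvf.
- by split; [exact: add0v | apply/directv_addP; exact: cap0v].
- by rewrite -dimv_eq0 dimvf dim_matrix.
- by move=> x _ y; rewrite J31E.
Qed.

(** The decomposition is [<a, b>] plus [<c>]: all products are multiples of [b], and [c] is
    central. *)
Lemma J32_central_component (K : fieldType) : has_central_component (@J32 K).
Proof.
have fullE : (<<[:: ea K; eb K]>> + <<[:: ec K]>> = fullv)%VS.
  apply/eqP; rewrite eqEsubv subvf -span_cat /=; apply/subvP => v _.
  apply: (span3P (v 0 0) (v 0 1) (v 0 2)).
  by apply: rowP3; rewrite !mxE /=; ring.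
have prod_eb x y : J32 x y \in <<[:: ea K; eb K]>>%VS.
  by rewrite J32E rpredZ // memv_span // !inE eqxx orbT.
have ecZ x y : x \in <<[:: ec K]>>%VS -> J32 x y = 0.
  rewrite span_seq1 => /vlineP[k ->].
  by rewrite J32E !mxE /= mulr0 mul0r scale0r.
have jm : is_jordan (@J32 K).
  by have [] := J3_list_nilpotent K 1; rewrite (tnth_nth (@J31 K)).
exists <<[:: ea K; eb K]>>%VS, <<[:: ec K]>>%VS; split.
- by move=> x y _; split.
- by move=> x y xI; rewrite (jordan_comm jm y) !ecZ // mem0v.
(* The sum is direct by dimension: the summands have dimension at most 2 and 1, and together they
   fill dimension 3. *)
- split=> //; rewrite directvEgeq /= fullE dimvf dim_matrix.
  by rewrite (leq_add (dim_span _) (dim_span _)).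
- rewrite span_seq1 -dimv_eq0 dim_vline eqb0 negbK.
  by apply/eqP/delta3_neq0.
- by move=> x xI y; apply: ecZ.
Qed.

Theorem theorem35 (R : realType) :
  [/\ forall i : 'I_5, nilpotent_jordan 3 (tnth (J3_list R) i),
      forall i j : 'I_5,
        i <> j -> ~ alg_iso (tnth (J3_list R) i) (tnth (J3_list R) j),
      forall (J : vectType R) (mul : J -> J -> J),
        nilpotent_jordan 3 mul ->
        exists i : 'I_5, alg_iso mul (tnth (J3_list R) i),
      has_central_component (@J31 R) /\ has_central_component (@J32 R)
    & (forall alpha : R, alpha = 1 \/ alpha = -1 ->
         ~ has_central_component (J33 alpha)) /\
      ~ has_central_component (@J34 R)].
Proof.
have jor (i : 'I_5) : is_jordan (nth (@J31 R) (J3_list R) i).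
  by rewrite -tnth_nth; case: (J3_list_nilpotent R i).
split; [exact: J3_list_nilpotent | exact: J3_list_pairwise
  | exact: classify_nilpotent | | split].
- split; [exact: J31_central_component | exact: J32_central_component].
- move=> alpha [] ->; apply: J33_no_central_component.
  + by rewrite oner_eq0.
  + exact: (jor 2).
  + by rewrite oppr_eq0 oner_eq0.
  + exact: (jor 3).
- exact/J34_no_central_component/(jor 4).
Qed.
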